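(* Let $1\le p<\infty$, let $n\ge 1$, let $X_1,\dots,X_n,Y$ be Banach spaces over $\mathbb{K}$ and let $T:X_1\times\cdots\times X_n\to Y$ be a continuous $n$-linear operator. Then $T$ is factorable strongly $p$-summing if and only if there exist a regular Borel probability measure $\mu$ on $B_{(X_1\widehat{\otimes}_\pi\cdots\widehat{\otimes}_\pi X_n)^*}$, endowed with the weak-star topology, and a constant $C\ge 0$ such that $$\left\|\sum_{i=1}^{m}\lambda^i T(x_1^i,\dots,x_n^i)\right\|\le C\left(\int_{B_{(X_1\widehat{\otimes}_\pi\cdots\widehat{\otimes}_\pi X_n)^*}}\left|\sum_{i=1}^{m}\lambda^i\varphi(x_1^i,\dots,x_n^i)\right|^p d\mu(\varphi)\right)^{1/p}$$ for all positive integers $m$, all scalars $\lambda^1,\dots,\lambda^m\in\mathbb{K}$ and all $x_k^i\in X_k$ ($1\le k\le n$, $1\le i\le m$).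
   Context: $\mathbb{K}=\mathbb{R}$ or $\mathbb{C}$. $B_Z$ denotes the closed unit ball of a Banach space $Z$. $X_1\widehat{\otimes}_\pi\cdots\widehat{\otimes}_\pi X_n$ is the completed projective tensor product; its dual is identified isometrically with the space of continuous $n$-linear forms on $X_1\times\cdots\times X_n$ with the sup norm, via $\varphi(x_1,\dots,x_n)=\varphi(x_1\otimes\cdots\otimes x_n)$. A continuous $n$-linear operator $T:X_1\times\cdots\times X_n\to Y$ is factorable strongly $p$-summing if there is a constant $C\ge0$ such that for all positive integers $m_1,m_2$, all $x_{k,j}^i\in X_k$ and all scalars $\lambda_j^i$ ($1\le k\le n$, $1\le j\le m_1$, $1\le i\le m_2$), $$\left(\sum_{j=1}^{m_1}\Big\|\sum_{i=1}^{m_2}\lambda_j^iT(x_{1,j}^i,\dots,x_{n,j}^i)\Big\|^p\right)^{1/p}\le C\sup_{\|\varphi\|\le1}\left(\sum_{j=1}^{m_1}\Big|\sum_{i=1}^{m_2}\lambda_j^i\varphi(x_{1,j}^i,\dots,x_{n,j}^i)\Big|^p\right)^{1/p},$$ where the supremum is over all continuous $n$-linear forms $\varphi:X_1\times\cdots\times X_n\to\mathbb{K}$ of norm at most $1$. *)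

(* Defs.v *)
From HB Require Import structures.
From mathcomp Require Import all_boot all_order all_algebra.
From mathcomp Require Import complex.
From mathcomp Require Import all_classical all_reals all_analysis.

Set Implicit Arguments.
Unset Strict Implicit.
Unset Printing Implicit Defensive.

Import Order.TTheory GRing.Theory Num.Theory.
Import numFieldNormedType.Exports.

Local Open Scope classical_set_scope.
Local Open Scope ring_scope.

Variant scalar_kind := RealScalars | ComplexScalars.

Definition scalar_field (R : realType) (k : scalar_kind) : numFieldType :=
  match k with
  | RealScalars => R
  | ComplexScalars => R[i]
  end.

Definition scalar_Re (R : realType) (k : scalar_kind) : scalar_field R k -> R :=
  match k with
  | RealScalars => fun a => a
  | ComplexScalars => fun z => complex.Re z
  end.

(* The norm of a normed module over K is valued in K; its values are real, so
   the norm is read in R through scalar_Re. *)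
Definition rnorm (R : realType) (k : scalar_kind)
    (V : normedModType (scalar_field R k)) (v : V) : R :=
  scalar_Re `|v|.

Section multilinear_maps.
Variables (R : realType) (k : scalar_kind) (n : nat).
Local Notation K := (scalar_field R k).
Variable X : 'I_n -> normedModType K.

(* dfwith x i u replaces the i-th component of x by u : X i. *)
Definition multilinear (W : lmodType K) (A : prod_topology X -> W) : Prop :=
  forall (x : prod_topology X) (i : 'I_n),
    linear (fun u : X i => A (dfwith x i u)).

Definition multilinear_norm (W : normedModType K)
    (A : prod_topology X -> W) : \bar R :=
  ereal_sup [set (rnorm (A x))%:E |
    x in [set x : prod_topology X | forall i, rnorm (x i) <= 1]].

Definition multilinear_form_ball : set (prod_topology X -> K^o) :=
  [set phi | [/\ multilinear phi, continuous phi
               & (multilinear_norm phi <= 1)%E]].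

(* A sequence s of elements of X_1 x ... x X_n stands for the element
   \sum_(x <- s) x_1 (x) ... (x) x_n of the algebraic tensor product; two such
   sums are the same tensor iff they have the same value under every n-linear
   form, continuous or not. *)
Definition same_tensor (s t : seq (prod_topology X)) : Prop :=
  forall A : prod_topology X -> K^o, multilinear A ->
    \sum_(x <- s) A x = \sum_(x <- t) A x.

Definition projective_norm (s : seq (prod_topology X)) : R :=
  inf [set \sum_(x <- t) \prod_(i < n) rnorm (x i) |
        t in [set t | same_tensor s t]].

(* The Banach space Z together with tau : (x_1, ..., x_n) |-> x_1 (x) ... (x) x_n
   is the completion of the algebraic tensor product for the projective norm;
   this determines (Z, tau) up to a unique isometric isomorphism. *)
Definition completed_projective_tensor (Z : completeNormedModType K)
    (tau : prod_topology X -> Z) : Prop :=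
  [/\ multilinear tau,
      forall s : seq (prod_topology X),
        rnorm (\sum_(x <- s) tau x) = projective_norm s
    & dense (range (fun s : seq (prod_topology X) => \sum_(x <- s) tau x))].

End multilinear_maps.

Section dual_ball.
Variables (R : realType) (k : scalar_kind).
Local Notation K := (scalar_field R k).
Variable Z : normedModType K.

Definition dual_norm (f : Z -> K^o) : \bar R :=
  ereal_sup [set (rnorm (f z))%:E | z in [set z : Z | rnorm z <= 1]].

Definition dual_ball_set : set {ptws Z -> K^o} :=
  [set f | [/\ linear (f : Z -> K^o), continuous (f : Z -> K^o)
             & (dual_norm f <= 1)%E]].

(* As a subspace of {ptws Z -> K^o}, the closed unit ball of the dual of Z
   carries the topology of pointwise convergence on Z, that is, the weak-star
   topology. *)
Definition dual_ball : Type := set_type dual_ball_set.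

HB.instance Definition _ := Topological.copy dual_ball (set_type dual_ball_set).

Lemma dual_ball_set0 : dual_ball_set (fun _ => 0).
Proof.
split=> /=.
- by move=> a u v; rewrite scaler0 addr0.
- by move=> z; exact: cvg_cst.
- apply: ge_ereal_sup => _ [z _ <-]; rewrite lee_fin /rnorm normr0.
  by rewrite (_ : scalar_Re _ = 0) ?ler01//; case: (k).
Qed.

Definition dual_ball0 : dual_ball := SigSub (mem_set dual_ball_set0).

HB.instance Definition _ := isPointed.Build dual_ball dual_ball0.

Definition dual_ball_borel := g_sigma_algebraType (@open dual_ball).

End dual_ball.

Definition regular_measure (R : realType) (T : topologicalType)
    (mu : set T -> \bar R) : Prop :=
  forall A : set T, <<s (@open T) >> A ->
    mu A = ereal_inf [set mu U | U in [set U | open U /\ A `<=` U]] /\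
    mu A = ereal_sup [set mu C | C in [set C | compact C /\ C `<=` A]].

Definition factorable_strongly_summing (R : realType) (k : scalar_kind)
    (n : nat) (X : 'I_n -> normedModType (scalar_field R k))
    (Y : normedModType (scalar_field R k)) (p : R) (T : prod_topology X -> Y) : Prop :=
  exists2 C : R, 0 <= C &
  forall (m1 m2 : nat) (lambda : 'I_m1 -> 'I_m2 -> scalar_field R k)
    (x : 'I_m1 -> 'I_m2 -> prod_topology X), (0 < m1)%N -> (0 < m2)%N ->
  (((\sum_(j < m1)
       rnorm (\sum_(i < m2) lambda j i *: T (x j i)) `^ p) `^ p^-1)%:E
   <= C%:E * ereal_sup
       [set ((\sum_(j < m1)
                rnorm (\sum_(i < m2) lambda j i *: phi (x j i)) `^ p)
             `^ p^-1)%:E | phi in @multilinear_form_ball R k n X])%E.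

(* Main.v *)
Require Import Defs.
From HB Require Import structures.
From mathcomp Require Import all_boot all_order all_algebra.
From mathcomp Require Import complex.
From mathcomp Require Import all_classical all_reals all_analysis.
From mathcomp Require Import measurable_realfun lra.
Set Implicit Arguments.
Unset Strict Implicit.
Unset Printing Implicit Defensive.
Import Order.TTheory GRing.Theory Num.Theory.
Import numFieldNormedType.Exports.
Local Open Scope classical_set_scope.
Local Open Scope ring_scope.

(** This is a Pietsch domination theorem.  A family of scalars and vectors
    stands for the tensor [l = \sum_i lambda_i x_1^i (x) ... (x) x_n^i]; write
    [T l] for [\sum_i lambda_i T (x^i)] and [f l] for the value at [l] of a
    functional [f] in the unit ball of the dual of the projective tensor
    product.

    If [|T l| <= C (\int |f l|^p dmu)^(1/p)] for all [l], then raising to the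
    power [p], adding over finitely many tensors and bounding the integrand by
    its supremum gives the summing inequality, because each [f] restricts to
    an [n]-linear form of norm at most one ([summing_of_domination]).

    Conversely, the summing inequality says that no nonnegative combination of
    the requirements [|T l|^p <= C^p |f l|^p] fails uniformly on the dual ball:
    the supremum over [n]-linear forms is one over functionals, as each form
    of norm at most one extends to the completed tensor product ([form_lift]),
    and positive weights are absorbed in the tensors.  By Hahn-Banach, applied
    to the sublinear functional measuring the best upper bound of a function
    modulo the cone of those combinations, a positive normalized linear
    functional [L] on the space of all bounded functions on the ball satisfies
    all the requirements in the mean ([dominating_mean]).

    Instead of the Riesz representation theorem, a one-sided regularization
    suffices.  The ball is weak-star compact and Hausdorff (Tychonoff), and
    [L] is defined on indicators, so [m A = L 1_A] is a finitely additive
    probability.  The outer measure that is the infimum over open [U]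
    containing [A] of the supremum of [m C] over closed [C] inside [U] has all
    open sets Caratheodory measurable, and restricts to a regular Borel
    probability [mu] with [m C <= mu C] for closed [C]
    ([regular_probability_ge_content]).  Comparing a continuous [f >= 0] with
    step functions over its closed level sets gives [L f <= \int f dmu]
    ([mean_le_integral]), and therefore
    [|T l|^p <= C^p \int |f l|^p dmu] ([regular_domination],
    [pietsch_domination]). *)

(** * Hahn-Banach theorem for sublinear functionals *)

Section hahn_banach.
Context {R : realType} {V : lmodType R}.
Implicit Types (q : V -> R) (u v : V).

(** Sublinear functionals.  Only [q (t *: u) <= t * q u] is asked for; for
    [t > 0] the converse inequality follows by applying it to [t^-1]. *)
Definition sublinear q : Prop :=
  (forall u v, q (u + v) <= q u + q v) /\
  (forall t u, 0 <= t -> q (t *: u) <= t * q u).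

Lemma sublinear0 q : sublinear q -> q 0 = 0.
Proof.
move=> [qD qZ]; apply/eqP; rewrite eq_le; apply/andP; split.
  by have := qZ 0 0 (lexx 0); rewrite scaler0 mul0r.
by have := qD 0 0; rewrite addr0 -[X in X <= _]addr0 lerD2l.
Qed.

Lemma sublinear_geN q v : sublinear q -> - q (- v) <= q v.
Proof.
move=> sq; rewrite -subr_ge0 opprK; have [qD _] := sq.
by rewrite -(sublinear0 sq) -(subrr v); exact: qD.
Qed.

(** The infimum of a chain of sublinear functionals is sublinear, so Zorn's
    lemma gives a minimal one below [q]. *)
Lemma minimal_sublinear q : sublinear q ->
  exists r, [/\ sublinear r, forall v, r v <= q v &
    forall s, sublinear s -> (forall v, s v <= r v) -> s = r].
Proof.
move=> sq.
pose P (r : V -> R) := sublinear r /\ forall v, r v <= q v.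
pose T := {r : V -> R | P r}.
pose le (r s : T) := `[< forall v, sval s v <= sval r v >].
have [||||r rmin] := @Zorn T le.
- by move=> r; apply/asboolP.
- move=> r s t /asboolP rs /asboolP st; apply/asboolP => v.
  exact: le_trans (st v) (rs v).
- move=> [r Hr] [s Hs] /asboolP/= rs /asboolP/= sr; apply: eq_exist.
  by apply/funext => v; apply/eqP; rewrite eq_le rs sr.
- move=> A totA; have [->|/set0P[r0 Ar0]] := eqVneq A set0.
    by exists (exist P q (conj sq (fun v => lexx _))).
  pose S v := [set sval r v | r in A].
  have S0 v : S v !=set0 by exists (sval r0 v); exists r0.
  have Slb v : lbound (S v) (- q (- v)).
    move=> _ [r _ <-]; have [sr rq] := svalP r.
    by apply: le_trans (sublinear_geN _ sr); rewrite lerN2 rq.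
  have hS v : has_inf (S v) by split => //; exists (- q (- v)); exact: Slb.
  have infS v r : A r -> inf (S v) <= sval r v.
    by move=> Ar; apply: ge_inf; [exact: (hS v).2|exists r].
  have sinf : sublinear (fun v => inf (S v)).
    split=> [u v|t u t0].
      rewrite -lerBlDr; apply: lb_le_inf => // _ [r Ar <-].
      rewrite lerBlDr -lerBlDl; apply: lb_le_inf => // _ [s As <-].
      rewrite lerBlDl.
      have [/asboolP rs|/asboolP sr] := totA _ _ Ar As.
        apply: le_trans (infS _ _ As) _; have [[sD _] _] := svalP s.
        by apply: le_trans (sD _ _) _; rewrite lerD2r.
      apply: le_trans (infS _ _ Ar) _; have [[sD _] _] := svalP r.
      by apply: le_trans (sD _ _) _; rewrite lerD2l.
    move: t0; rewrite le_eqVlt => /orP[/eqP <-|t0].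
      rewrite mul0r; apply: le_trans (infS _ _ Ar0) _.
      by have [sr _] := svalP r0; rewrite scale0r sublinear0.
    rewrite -ler_pdivrMl//; apply: lb_le_inf => // _ [r Ar <-].
    rewrite ler_pdivrMl//; apply: le_trans (infS _ _ Ar) _.
    by have [[_ sZ] _] := svalP r; apply: sZ; exact: ltW.
  have infq v : inf (S v) <= q v.
    by apply: le_trans (infS _ _ Ar0) _; have [_ ] := svalP r0.
  exists (exist P _ (conj sinf infq)) => r Ar; apply/asboolP => v /=.
  exact: infS.
have [sr rq] := svalP r; exists (sval r); split => // s ss sr'.
have sq' v : s v <= q v by exact: le_trans (sr' v) (rq v).
by rewrite -(rmin (exist P s (conj ss sq')))//; apply/asboolP.
Qed.

(** Hahn-Banach: a sublinear functional dominates a linear one.  A minimal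
    sublinear [r] is additive because, for each [v], the functional
    [u |-> inf_(t >= 0) (r (u + t *: v) - t * r v)] is sublinear and below
    [r]. *)
Lemma hahn_banach q : sublinear q ->
  exists L : {scalar V}, forall v, L v <= q v.
Proof.
move=> /minimal_sublinear[r [sr rq rmin]].
have [rD rZ] := sr.
have add u v : r (u + v) = r u + r v.
  apply/eqP; rewrite eq_le rD/=; move: u v => w v.
  (* [inf (S u)] is the functional of the comment above; it equals [r u] by
     minimality, and [t = 1] gives the missing inequality. *)
  pose S u := [set r (u + t *: v) - t * r v | t in [set t : R | 0 <= t]].
  have S0 u : S u !=set0 by exists (r (u + 0 *: v) - 0 * r v); exists 0 => /=.
  have Slb u : lbound (S u) (- r (- u)).
    move=> _ [t /= t0 <-]; rewrite lerBrDl.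
    have [->|tN0] := eqVneq t 0.
      by rewrite mul0r scale0r add0r addr0; exact: sublinear_geN.
    have tp : 0 < t by rewrite lt_neqAle eq_sym tN0.
    have rtv : t * r v <= r (t *: v).
      rewrite -ler_pdivlMl//; apply: le_trans (rZ _ _ _); last first.
        by rewrite invr_ge0.
      by rewrite scalerA mulVf// scale1r.
    rewrite lerBlDr; apply: (le_trans rtv); apply: le_trans (rD _ _).
    by rewrite addrAC subrr add0r.
  have infS u t : 0 <= t -> inf (S u) <= r (u + t *: v) - t * r v.
    by move=> t0; apply: ge_inf; [exists (- r (- u)); exact: Slb|exists t].
  have sS : sublinear (fun u => inf (S u)).
    split=> [u u'|a u].
      rewrite -lerBlDr; apply: lb_le_inf => // _ [t /= t0 <-].
      rewrite lerBlDr -lerBlDl; apply: lb_le_inf => // _ [s /= s0 <-].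
      rewrite lerBlDl; apply: le_trans (infS _ _ (addr_ge0 t0 s0)) _.
      rewrite mulrDl opprD [leRHS]addrACA lerD2r.
      have -> : u + u' + (t + s) *: v = (u + t *: v) + (u' + s *: v).
        by rewrite scalerDl addrACA.
      exact: rD.
    rewrite le_eqVlt => /orP[/eqP <-|a0].
      rewrite scale0r mul0r; apply: le_trans (infS _ _ (lexx 0)) _.
      by rewrite add0r scale0r mul0r subr0 sublinear0.
    rewrite -ler_pdivrMl//; apply: lb_le_inf => // _ [t /= t0 <-].
    rewrite ler_pdivrMl//; apply: le_trans (infS _ _ (mulr_ge0 (ltW a0) t0)) _.
    rewrite mulrBr mulrA lerD2r -scalerA -scalerDr; exact/rZ/ltW.
  have Sr u : inf (S u) <= r u.
    by apply: le_trans (infS u _ (lexx 0)) _; rewrite scale0r addr0 mul0r subr0.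
  have <- := congr1 (@^~ w) (rmin _ sS Sr).
  by have := infS w 1 ler01; rewrite scale1r mul1r lerBrDr.
have rN u : r (- u) = - r u.
  by apply/eqP; rewrite -addr_eq0 -add addNr sublinear0.
have scaleP t u : 0 <= t -> r (t *: u) = t * r u.
  move=> t0; apply/eqP; rewrite eq_le rZ//=.
  by have := rZ t (- u) t0; rewrite scalerN !rN mulrN lerN2.
have lr : linear_for *%R r.
  move=> t u v; rewrite add; congr (_ + _).
  have [t0|t0] := leP 0 t; first exact: scaleP.
  apply: oppr_inj; rewrite -rN -scaleNr -mulNr scaleP// oppr_ge0; exact: ltW.
pose L := GRing.isLinear.Build R V R *%R r lr.
pose Lr : {scalar V} := HB.pack r L.
by exists Lr.
Qed.

End hahn_banach.

(** * Means on bounded functions *)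

Section bounded_functions.
Context {R : realType} {T : Type}.

(** Boundedness of a function; the codomain is [R^o] so that functions form
    a vector space. *)
Definition bounded_pred : {pred T -> R^o} :=
  [pred f | `[< exists M, forall x, `|f x| <= M >] ].

Lemma bounded_submod : submod_closed bounded_pred.
Proof.
split; first by apply/asboolP; exists 0 => x; rewrite normr0.
move=> t f g /asboolP[M fM] /asboolP[N gN]; apply/asboolP.
exists (`|t| * M + N) => x.
apply: le_trans (ler_normD _ _) _; apply: lerD; last exact: gN.
by rewrite normrM ler_wpM2l.
Qed.

HB.instance Definition _ :=
  GRing.isSubmodClosed.Build R (T -> R^o) bounded_pred bounded_submod.

(** The vector space of bounded real functions on [T]. *)
Record bfun := BFun { bfun_val :> T -> R^o ; bfunP : bfun_val \in bounded_pred }.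

HB.instance Definition _ := [isSub for bfun_val].
HB.instance Definition _ := [Choice of bfun by <:].
HB.instance Definition _ := [SubChoice_isSubLmodule of bfun by <:].

Lemma bfun_bounded (f : bfun) : exists M, forall x, `|f x| <= M.
Proof. by have /asboolP := bfunP f. Qed.

Lemma bfunDE (f g : bfun) x : (f + g) x = f x + g x. Proof. by []. Qed.
Lemma bfunNE (f : bfun) x : (- f) x = - f x. Proof. by []. Qed.

Lemma bfun_ext (f g : bfun) : (forall x, f x = g x) -> f = g.
Proof. by move=> fg; apply/val_inj/funext. Qed.

(** If no nonnegative combination of the requirements [a i <= f i] fails by
    more than one everywhere, then some positive normalized linear functional
    satisfies all of them.  The slack one is harmless, since the combinations
    form a cone. *)
Lemma dominating_mean (I : Type) (f : I -> bfun) (a : I -> R) :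
  (forall w : seq (R * I), all (fun c => 0 <= c.1) w -> exists x : T,
     \sum_(c <- w) c.1 * a c.2 <= \sum_(c <- w) c.1 * f c.2 x + 1) ->
  exists L : {scalar bfun},
    (forall (g : bfun) M, (forall x, g x <= M) -> L g <= M) /\
    (forall i, a i <= L (f i)).
Proof.
move=> H.
(* The upper bounds of [g] up to a combination of the [f i - a i]. *)
pose S (g : bfun) := [set M : R | exists2 w : seq (R * I),
  all (fun c => 0 <= c.1) w &
  forall x, g x + \sum_(c <- w) c.1 * (f c.2 x - a c.2) <= M].
pose q g := inf (S g).
have Sub (g : bfun) M : (forall x, g x <= M) -> S g M.
  by move=> gM; exists [::] => // x; rewrite big_nil addr0.
have S0 g : S g !=set0.
  have [M gM] := bfun_bounded g; exists M; apply: Sub => x.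
  exact: le_trans (ler_norm _) (gM x).
have Slb g : has_lbound (S g).
  have [M gM] := bfun_bounded g; exists (- M - 1) => N [w w0 wN].
  have [x Hx] := H w w0; apply: le_trans (wN x); apply: lerD.
    by rewrite lerNl; apply: le_trans (gM x); rewrite -normrN ler_norm.
  under eq_bigr do rewrite mulrBr.
  by rewrite big_split/= sumrN lerBrDl lerBlDr.
have qle g M : S g M -> q g <= M by move=> SM; apply: ge_inf.
have sq : sublinear q.
  split=> [u v|t u].
    rewrite -lerBlDr; apply: lb_le_inf => // M [w w0 wM].
    rewrite lerBlDr -lerBlDl; apply: lb_le_inf => // N [z z0 zN].
    rewrite lerBlDl; apply: qle; exists (w ++ z); first by rewrite all_cat w0 z0.
    by move=> x; rewrite bfunDE big_cat/= addrACA lerD.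
  rewrite le_eqVlt => /orP[/eqP <-|t0].
    by rewrite mul0r; apply/qle/Sub => x; rewrite -[leLHS]/(0 * u x) mul0r.
  rewrite -ler_pdivrMl//; apply: lb_le_inf => // M [w w0 wM].
  rewrite ler_pdivrMl//; apply: qle.
  exists [seq (t * c.1, c.2) | c <- w].
    rewrite all_map; apply: sub_all w0 => c /= c0; exact: mulr_ge0 (ltW t0) c0.
  move=> x; rewrite big_map/= -[X in X + _]/(t * u x).
  under eq_bigr do rewrite -mulrA.
  by rewrite -mulr_sumr -mulrDr ler_pM2l.
have [L Lq] := hahn_banach sq.
exists L; split=> [g M gM|i]; first exact: le_trans (Lq g) (qle _ _ (Sub _ _ gM)).
rewrite -lerN2 -raddfN; apply: le_trans (Lq _) _; apply: qle.
exists [:: (1, i)]; first by rewrite /= ler01.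
by move=> x; rewrite big_seq1 mul1r bfunNE addrA addNr add0r.
Qed.

End bounded_functions.
Arguments bfun R T : clear implicits.

(** * Regular Borel probabilities from finitely additive ones *)

Section regularization.
Context {R : realType} {T : ptopologicalType}.
(* [m] is a finitely additive probability defined on all subsets of [T]. *)
Variable m : set T -> R.
Hypotheses (cptT : compact [set: T]) (hT : hausdorff_space T).
Hypotheses (m_ge0 : forall A, 0 <= m A) (mT : m setT = 1).
Hypothesis mU : forall A B, A `&` B = set0 -> m (A `|` B) = m A + m B.

Let m0 : m set0 = 0.
Proof.
have := mU (setI0 (@set0 T)); rewrite setU0 => /eqP.
by rewrite -[X in X == _]addr0 (inj_eq (addrI _)) => /eqP <-.
Qed.

Let le_m A B : A `<=` B -> m A <= m B.
Proof.
move=> AB; rewrite -(setDUK AB) mU; first by rewrite lerDl.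
by rewrite setDE setICA setICr setI0.
Qed.

Let m_le1 A : m A <= 1. Proof. by rewrite -mT le_m. Qed.

Let mUle A B : m (A `|` B) <= m A + m B.
Proof.
have -> : A `|` B = A `|` (B `\` A) by rewrite setDE setUIr setUv setIT.
rewrite mU; last by rewrite setDE setICA setICr setI0.
by rewrite lerD2l le_m.
Qed.

(** The mass of [U] approximated from inside by closed sets; it is meant for
    open [U]. *)
Definition inner_content (U : set T) : \bar R :=
  ereal_sup [set (m C)%:E | C in [set C | closed C /\ C `<=` U]].

(** The outer measure of [A], approximated from outside by open sets. *)
Definition outer_content (A : set T) : \bar R :=
  ereal_inf [set inner_content U | U in [set U | open U /\ A `<=` U]].

Local Open Scope ereal_scope.

Lemma content_le_inner C U : closed C -> C `<=` U -> (m C)%:E <= inner_content U.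
Proof. by move=> cC CU; apply: ereal_sup_ubound; exists C. Qed.

Lemma inner_content_ge0 U : 0 <= inner_content U.
Proof. by rewrite -[0]/(0%:E) -m0; apply: content_le_inner => //; exact: closed0. Qed.

Lemma inner_content_le1 U : inner_content U <= 1.
Proof. by apply: ge_ereal_sup => _ [C _ <-]; rewrite lee_fin. Qed.

Lemma le_inner_content U V : U `<=` V -> inner_content U <= inner_content V.
Proof.
move=> UV; apply: ge_ereal_sup => _ [C [cC CU] <-].
by apply: content_le_inner => //; exact: subset_trans UV.
Qed.

Lemma outer_content_ge0 A : 0 <= outer_content A.
Proof. by apply: le_ereal_inf_tmp => _ [U _ <-]; exact: inner_content_ge0. Qed.

Lemma le_outer_content A B : A `<=` B -> outer_content A <= outer_content B.
Proof.
move=> AB; apply: le_ereal_inf_tmp => _ [U [oU BU] <-].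
by apply: ereal_inf_lbound; exists U => //; split => //; exact: subset_trans BU.
Qed.

Lemma outer_content_open U : open U -> outer_content U = inner_content U.
Proof.
move=> oU; apply/eqP; rewrite eq_le; apply/andP; split.
  by apply: ereal_inf_lbound; exists U; first split.
by apply: le_ereal_inf_tmp => _ [V [_ UV] <-]; exact: le_inner_content.
Qed.

Lemma outer_content_le1 A : outer_content A <= 1.
Proof.
apply: le_trans (inner_content_le1 setT); rewrite -outer_content_open; last exact: openT.
by apply: le_outer_content.
Qed.

Lemma outer_content_fin A : outer_content A \is a fin_num.
Proof.
rewrite ge0_fin_numE ?outer_content_ge0//.
exact: le_lt_trans (outer_content_le1 A) (ltry _).
Qed.

Lemma outer_content0 : outer_content set0 = 0.
Proof.
rewrite outer_content_open; last exact: open0.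
apply/eqP; rewrite eq_le inner_content_ge0 andbT.
by apply: ge_ereal_sup => _ [C [_ C0] <-]; rewrite (_ : C = set0) ?m0//; apply/seteqP; split.
Qed.

Lemma outer_content_closed C : closed C -> (m C)%:E <= outer_content C.
Proof.
move=> cC; apply: le_ereal_inf_tmp => _ [U [_ CU] <-].
exact: content_le_inner.
Qed.

Lemma outer_contentT : outer_content setT = 1.
Proof.
apply/eqP; rewrite eq_le outer_content_le1/= -mT.
by apply: outer_content_closed; exact: closedT.
Qed.

(** In a normal space a closed set covered by two open sets is the union of
    two closed sets, one inside each of them. *)
Lemma inner_contentU U V : open U -> open V ->
  inner_content (U `|` V) <= inner_content U + inner_content V.
Proof.
move=> oU oV; apply: ge_ereal_sup => _ [C [cC CUV] <-].
have cCU : closed (C `\` U) by apply: closedI => //; exact: open_closedC.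
have : set_nbhs (C `\` U) V.
  by apply/set_nbhsP; exists V; split => // x [/CUV[]].
move=> /(compact_normal hT cptT cCU)[W /set_nbhsP[W' [oW' CW' W'W]] WV].
have cC1 : closed (C `\` W') by apply: closedI => //; exact: open_closedC.
have cC2 : closed (C `&` closure W) by apply: closedI => //; exact: closed_closure.
have C12 : C `<=` (C `\` W') `|` (C `&` closure W).
  move=> x Cx; have [W'x|nW'x] := pselect (W' x); last by left.
  by right; split => //; apply: subset_closure; exact: W'W.
have h1 : (m (C `\` W'))%:E <= inner_content U.
  apply: content_le_inner => // x [Cx nW'x]; apply: contrapT => nUx.
  by apply: nW'x; exact: CW'.
have h2 : (m (C `&` closure W))%:E <= inner_content V.
  by apply: content_le_inner => // x [_ /WV].
apply: le_trans (leeD h1 h2).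
rewrite -EFinD lee_fin; apply: le_trans (mUle _ _); exact: le_m.
Qed.

Lemma inner_content_bigU (U : (set T)^nat) n : (forall i, open (U i)) ->
  inner_content (\big[setU/set0]_(i < n) U i) <= \sum_(i < n) inner_content (U i).
Proof.
move=> oU; elim: n => [|n IH].
  by rewrite !big_ord0 -outer_content_open ?outer_content0//; exact: open0.
rewrite !big_ord_recr/=; apply: le_trans (leeD IH (lexx _)).
apply: inner_contentU => //; rewrite -(big_mkord xpredT); apply: big_ind => //.
  exact: open0.
by move=> ? ?; exact: openU.
Qed.

Lemma inner_content_bigcup (U : (set T)^nat) : (forall i, open (U i)) ->
  inner_content (\bigcup_i U i) <= \sum_(i <oo) inner_content (U i).
Proof.
move=> oU; apply: ge_ereal_sup => _ [C [cC CU] <-].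
have cptC : compact C by exact: subclosed_compact cptT _.
move: (cptC); rewrite compact_cover => /(_ nat setT U).
move=> /(_ (fun i _ => oU i)) [//|D _ CD].
pose n := (\max_(i <- finmap.enum_fset D) i).+1.
have CUn : C `<=` \big[setU/set0]_(i < n) U i.
  move=> x /CD[i /= iD Uix]; rewrite -bigcup_mkord; exists i => //=.
  by rewrite ltnS; exact: (@leq_bigmax_seq _ _ xpredT id).
apply: le_trans (content_le_inner cC CUn) _.
apply: le_trans (inner_content_bigU _ oU) _.
rewrite -(big_mkord xpredT (fun i => inner_content (U i))).
by apply: nneseries_lim_ge => i _ _; exact: inner_content_ge0.
Qed.

Lemma outer_content_sigma_subadditive : sigma_subadditive outer_content.
Proof.
move=> A; apply/lee_addgt0Pr => _/posnumP[e].
apply: le_trans (epsilon_trick _ _ _) => //; last first.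
  by move=> n; exact: outer_content_ge0.
have /choice[U HU] n : exists U : set T, [/\ open U, A n `<=` U &
    inner_content U <= outer_content (A n) + (e%:num / (2 ^ n.+1)%:R)%:E].
  have en : (0 < e%:num / (2 ^ n.+1)%:R :> R)%R by [].
  have [_ [U [oU AU] <-] /ltW Ue] := lb_ereal_inf_adherent en (outer_content_fin (A n)).
  by exists U.
apply: (@le_trans _ _ (inner_content (\bigcup_n U n))).
  apply: ereal_inf_lbound; exists (\bigcup_n U n) => //; split.
    by apply: bigcup_open => i _; have [] := HU i.
  by apply: subset_bigcup => i _; have [] := HU i.
apply: le_trans (inner_content_bigcup _) _; first by move=> i; have [] := HU i.
apply: lee_nneseries => [i _ _|i _]; first exact: inner_content_ge0.
by have [] := HU i.
Qed.

HB.instance Definition _ := isOuterMeasure.Build R T outer_content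
  outer_content0 outer_content_ge0 le_outer_content outer_content_sigma_subadditive.

(** For [V] open containing the test set, a closed [C] inside [V `&` U] and a
    closed [D] inside [V `\` C] are disjoint, so [m C + m D] is at most the
    inner content of [V]. *)
Lemma outer_content_caratheodory U : open U -> outer_content.-caratheodory U.
Proof.
move=> oU; apply: le_caratheodory_measurable => X.
apply: le_ereal_inf_tmp => _ [V [oV XV] <-].
apply: (@le_trans _ _ (outer_content (V `&` U) + outer_content (V `\` U))).
  by apply: leeD; apply: le_outer_content; exact: setSI.
rewrite outer_content_open; last exact: openI.
rewrite -leeBrDr ?outer_content_fin//; apply: ge_ereal_sup => _ [C [cC CVU] <-].
rewrite leeBrDr ?outer_content_fin//.
apply: (@le_trans _ _ ((m C)%:E + inner_content (V `\` C))).
  apply: leeD => //; apply: ereal_inf_lbound; exists (V `\` C) => //; split.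
    by rewrite setDE; apply: openI => //; exact: closed_openC.
  by move=> x [Vx nUx]; split => // /CVU[].
rewrite addeC -leeBrDr//; apply: ge_ereal_sup => _ [D [cD DV] <-].
rewrite leeBrDr// -EFinD -mU; last first.
  by apply/seteqP; split => // x [/DV[]].
apply: content_le_inner; first exact: closedU.
by move=> x [/DV[]|/CVU[]].
Qed.

(** The outer measure seen on the Borel sigma-algebra, where it is a
    probability. *)
Definition content_measure (A : set (g_sigma_algebraType (@open T))) : \bar R :=
  outer_content A.

Lemma borel_caratheodory (A : set (g_sigma_algebraType (@open T))) :
  measurable A -> outer_content.-caratheodory A.
Proof.
move=> mA; apply: mA; split; last by move=> U /= ; exact: outer_content_caratheodory.
split.
- exact: caratheodory_measurable_set0.
- by move=> B; rewrite setTD; exact: caratheodory_measurable_setC.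
- exact: caratheodory_measurable_bigcup.
Qed.

Let content_measure0 : content_measure set0 = 0.
Proof. exact: outer_content0. Qed.

Let content_measure_ge0 A : 0 <= content_measure A.
Proof. exact: outer_content_ge0. Qed.

Let content_measure_sigma_additive : semi_sigma_additive content_measure.
Proof.
move=> F mF tF _.
apply: (@caratheodory_measure_sigma_additive R T outer_content) => //.
  by move=> i; apply: borel_caratheodory.
by apply: borel_caratheodory; exact: bigcup_measurable.
Qed.

HB.instance Definition _ := isMeasure.Build _ _ _ content_measure
  content_measure0 content_measure_ge0 content_measure_sigma_additive.

HB.instance Definition _ := Measure_isProbability.Build _ _ _ content_measure
  outer_contentT.

(** Outer regularity holds by construction; inner regularity follows by taking
    complements, as the total mass is finite. *)
Lemma content_measure_regular (A : set T) : <<s (@open T) >> A ->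
  content_measure A = ereal_inf
    [set content_measure U | U in [set U | open U /\ A `<=` U]] /\
  content_measure A = ereal_sup
    [set content_measure C | C in [set C | compact C /\ C `<=` A]].
Proof.
move=> mA; split.
  by congr (ereal_inf _); apply/seteqP; split => _ [U [oU AU] <-]; exists U => //;
    rewrite /content_measure outer_content_open.
apply/eqP; rewrite eq_le; apply/andP; split; last first.
  by apply: ge_ereal_sup => _ [C [_ CA] <-]; exact: le_outer_content.
apply/lee_addgt0Pr => e e0.
have [_ [U [oU AU] <-]] := lb_ereal_inf_adherent e0 (outer_content_fin (~` A)).
rewrite -outer_content_open// => /ltW Ue.
have mU' : measurable (U : set (g_sigma_algebraType (@open T))).
  by apply: sub_sigma_algebra.
have CU : content_measure (~` U) <= ereal_sup
    [set content_measure C | C in [set C | compact C /\ C `<=` A]].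
  apply: ereal_sup_ubound; exists (~` U) => //; split.
    by apply: subclosed_compact cptT _ => //; exact: open_closedC.
  by rewrite -[X in _ `<=` X]setCK; exact: subsetC.
apply: le_trans (leeD CU (lexx _)); move: Ue {CU}.
have mC (B : set (g_sigma_algebraType (@open T))) : measurable B ->
    content_measure (~` B) = 1 - content_measure B.
  exact: (probability_setC (content_measure : probability _ R)).
rewrite mC// -[ereal_inf _]/(content_measure (~` A)) (mC A)//.
rewrite -[outer_content U]/(content_measure U).
have fin B : content_measure B \is a fin_num by exact: outer_content_fin.
rewrite -(fineK (fin A)) -(fineK (fin U)) -!EFinB -!EFinD !lee_fin; lra.
Qed.

(** A finitely additive probability on a compact Hausdorff space is dominated,
    on closed sets, by a regular Borel probability. *)
Lemma regular_probability_ge_content :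
  exists mu : probability (g_sigma_algebraType (@open T)) R,
    regular_measure mu /\ forall C, closed C -> (m C)%:E <= mu C.
Proof.
exists content_measure; split; last exact: outer_content_closed.
exact: content_measure_regular.
Qed.

End regularization.

(** * Domination by integrals on a compact Hausdorff space *)

(** [S] counts the integers in [1..N] that are at most [y]. *)
Lemma ler_count_levels (R : realDomainType) (N : nat) (y : R) :
  let S := \sum_(k < N) (k.+1%:R <= y)%R%:R in
  0 <= y -> S <= y /\ (y <= N%:R -> y <= S + 1).
Proof.
move=> S y0; suff [/= Sy SN [//|SE]] : [/\ S <= y, S <= N%:R & y <= S + 1 \/ S = N%:R].
  by split => // yN; apply: le_trans yN _; rewrite SE lerDl.
rewrite {}/S; elim: N => [|N [Sy SN IH]].
  by rewrite big_ord0; split => //; right.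
rewrite big_ord_recr/=; set S := \sum_(k < N) _ in Sy SN IH *.
rewrite -natr1 in SN *; case: (leP (N%:R + 1) y) => [Ny|yN] /=.
  have SE : S = N%:R.
    by case: IH => // yS; apply/eqP; rewrite eq_le SN -(lerD2r 1) (le_trans Ny).
  by rewrite SE; split => //; right.
rewrite addr0; split => //; first by apply: le_trans SN _; rewrite lerDl.
by left; case: IH => // ->; exact: ltW.
Qed.

Section domination.
Context {R : realType} {T : ptopologicalType}.
Hypotheses (cptT : compact [set: T]) (hT : hausdorff_space T).

Lemma continuous_bounded_pred (f : T -> R) : continuous f ->
  (f : T -> R^o) \in bounded_pred.
Proof.
move=> cf; apply/asboolP.
have : compact (f @` [set: T]).
  apply: continuous_compact => //; exact: continuous_subspaceT.
move=> /compact_bounded[M [_ HM]]; exists (M + 1) => x.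
by apply: (HM (M + 1)); [rewrite ltrDl|exists x].
Qed.

Lemma indic_bounded_pred (A : set T) : (\1_A : T -> R^o) \in bounded_pred.
Proof.
apply/asboolP; exists 1 => x; rewrite indicE.
by case: (x \in A); rewrite /= ?normr1 ?normr0.
Qed.

Lemma continuous_measurable_borel (f : T -> R) : continuous f ->
  measurable_fun [set: g_sigma_algebraType (@open T)] f.
Proof.
move=> cf; apply: (measurability _ (RGenOpens.measurableE R)).
move=> _ [_ [a [b ->] <-]]; apply: sub_sigma_algebra; rewrite setTI.
by move/continuousP : cf; apply; exact: interval_open.
Qed.

(** A continuous [f >= 0] is squeezed between the sums [e * \sum_k 1_(C_k)]
    over its closed level sets [C_k = {f >= k.+1 * e}] and the same sums plus
    [e], which compares the mean with the integral. *)
Lemma mean_le_integral (L : {scalar (bfun R T)})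
    (mu : probability (g_sigma_algebraType (@open T)) R) (f : bfun R T) :
  (forall (g : bfun R T) M, (forall x, g x <= M) -> L g <= M) ->
  (forall C, closed C -> ((L (BFun (indic_bounded_pred C)))%:E <= mu C)%E) ->
  continuous (f : T -> R) -> (forall x, 0 <= f x) ->
  ((L f)%:E <= \int[mu]_(x in setT) (f x)%:E)%E.
Proof.
move=> LM Lmu cf f0; apply/lee_addgt0Pr => e e0.
have [M fM] := bfun_bounded f.
(* [M] bounds [f], so [N] levels of height [e] suffice. *)
pose N := (Num.truncn (M / e)).+1.
have fN x : f x / e <= N%:R.
  apply: le_trans (ltW (truncnS_gt _)); rewrite ler_pM2r ?invr_gt0//.
  exact: le_trans (ler_norm _) (fM x).
pose C (k : nat) := [set x : T | k.+1%:R * e <= f x].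
have cC k : closed (C k).
  rewrite (_ : C k = f @^-1` [set y | k.+1%:R * e <= y])//.
  by apply: closed_comp => // x _; exact: cf.
pose ind k := BFun (indic_bounded_pred (C k)).
have indE k x : ind k x = (k.+1%:R <= f x / e)%R%:R.
  rewrite /= indicE; congr (nat_of_bool _)%:R; rewrite ler_pdivlMr//.
  by apply/idP/idP; rewrite inE.
have h x := ler_count_levels N (divr_ge0 (f0 x) (ltW e0)).
have Lf : L f <= e * \sum_(k < N) L (ind k) + e.
  rewrite -lerBlDl -linear_sum/= -linearZ -linearB; apply: LM => x.
  have -> : (f - e *: \sum_(k < N) ind k) x = f x - e * \sum_(k < N) (ind k x).
    rewrite bfunDE bfunNE; congr (_ - _ * _).
    by apply: (big_ind2 (fun (g : bfun R T) s => g x = s)) => // g _ g' _ <- <-.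
  rewrite lerBlDl; have [_ /(_ (fN x))] := h x.
  rewrite ler_pdivrMr// mulrDl mul1r mulrC; congr (_ <= _ * _ + _).
  by apply: eq_bigr => k _; rewrite indE.
apply: (@le_trans _ _ ((e * \sum_(k < N) L (ind k) + e)%:E)).
  by rewrite lee_fin.
rewrite EFinD leeD2r// EFinM -sumEFin.
apply: (@le_trans _ _ (e%:E * \sum_(k < N) mu (C k))%E).
  by rewrite lee_pmul2l ?lte_fin//; apply: lee_sum => k _; exact: Lmu.
have mC k : measurable (C k : set (g_sigma_algebraType (@open T))).
  rewrite -[C k]setCK; apply: measurableC; apply: sub_sigma_algebra.
  exact: closed_openC.
have -> : (\sum_(k < N) mu (C k) = \int[mu]_(x in setT) \sum_(k < N) (\1_(C k) x)%:E)%E.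
  rewrite ge0_integral_sum//.
  - by apply: eq_bigr => k _; rewrite integral_indic// setIT.
  - by move=> k; apply/measurable_EFinP; exact: measurable_indic.
rewrite -ge0_integralZl//; last 3 first.
- apply: emeasurable_sum => k; apply/measurable_EFinP; exact: measurable_indic.
- by move=> x _; apply: sume_ge0 => k _; rewrite lee_fin.
- by rewrite lee_fin ltW.
apply: ge0_le_integral => //.
- move=> x _; apply: mule_ge0; first by rewrite lee_fin ltW.
  by apply: sume_ge0 => k _; rewrite lee_fin.
- apply: emeasurable_funM => //; apply: emeasurable_sum => k.
  apply/measurable_EFinP; exact: measurable_indic.
- by apply/measurable_EFinP; exact: continuous_measurable_borel.
move=> x _; rewrite sumEFin -EFinM lee_fin.
have [+ _] := h x; rewrite ler_pdivlMr// mulrC; apply: le_trans.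
by rewrite ler_pM2l//; apply: ler_sum => k _; rewrite -indE.
Qed.

(** If no nonnegative combination of the requirements [a i <= f i] fails by
    more than one everywhere, then a single regular probability satisfies
    all of them after integration. *)
Theorem regular_domination (I : Type) (f : I -> T -> R) (a : I -> R) :
  (forall i, continuous (f i)) -> (forall i x, 0 <= f i x) ->
  (forall w : seq (R * I), all (fun c => 0 <= c.1) w -> exists x : T,
     \sum_(c <- w) c.1 * a c.2 <= \sum_(c <- w) c.1 * f c.2 x + 1) ->
  exists mu : probability (g_sigma_algebraType (@open T)) R,
    regular_measure mu /\
    forall i, ((a i)%:E <= \int[mu]_(x in setT) (f i x)%:E)%E.
Proof.
move=> cf f0 H.
pose F i := BFun (continuous_bounded_pred (cf i)).
have [L [LM La]] := @dominating_mean R T I F a H.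
pose m (A : set T) := L (BFun (indic_bounded_pred A)).
have L0 (g : bfun R T) : (forall x, 0 <= g x) -> 0 <= L g.
  move=> g0; rewrite -oppr_le0 -raddfN; apply: LM => x.
  by rewrite bfunNE oppr_le0.
have m_ge0 A : 0 <= m A by apply: L0 => x /=.
have mT : m setT = 1.
  apply/eqP; rewrite eq_le; apply/andP; split.
    by apply: LM => x /=; rewrite indicT.
  rewrite -lerN2 -raddfN; apply: LM => x.
  by rewrite bfunNE /= indicT.
have mU A B : A `&` B = set0 -> m (A `|` B) = m A + m B.
  move=> AB0; rewrite -raddfD; congr (L _); apply: bfun_ext => x.
  rewrite bfunDE /= !indicE in_setU.
  case: (boolP (x \in A)); case: (boolP (x \in B)) => //=; rewrite ?addr0 ?add0r//.
  by rewrite !inE => Bx Ax; have : set0 x by rewrite -AB0.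
have [mu [rmu mmu]] := regular_probability_ge_content cptT hT m_ge0 mT mU.
exists mu; split => // i; apply: (@le_trans _ _ (L (F i))%:E).
  by rewrite lee_fin.
apply: (mean_le_integral LM mmu); first exact: cf.
by move=> x; exact: f0.
Qed.

End domination.

(** * Real-valued norms over the real or complex field *)

Section scalars.
Context {R : realType} {k : scalar_kind}.
Local Notation K := (scalar_field R k).

(** The inclusion of the reals in the field of scalars. *)
Definition scalar_of_real : R -> K :=
  match k return R -> scalar_field R k with
  | RealScalars => fun r => r
  | ComplexScalars => fun r => real_complex R r
  end.

Lemma scalar_of_realK : cancel scalar_of_real (@scalar_Re R k).
Proof. by rewrite /scalar_of_real; case: k. Qed.

Lemma ler_scalar r s : (scalar_of_real r <= scalar_of_real s) = (r <= s).
Proof. by rewrite /scalar_of_real; case: k => //=; exact: lecR. Qed.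

Lemma ltr_scalar r s : (scalar_of_real r < scalar_of_real s) = (r < s).
Proof. by rewrite /scalar_of_real; case: k => //=; exact: ltcR. Qed.

Lemma scalar_of_realD r s :
  scalar_of_real (r + s) = scalar_of_real r + scalar_of_real s.
Proof. by rewrite /scalar_of_real; case: k => //=; exact: rmorphD. Qed.

Lemma scalar_of_realM r s :
  scalar_of_real (r * s) = scalar_of_real r * scalar_of_real s.
Proof. by rewrite /scalar_of_real; case: k => //=; exact: rmorphM. Qed.

Lemma scalar_of_real0 : scalar_of_real 0 = 0.
Proof. by rewrite /scalar_of_real; case: k. Qed.

Lemma scalar_of_real1 : scalar_of_real 1 = 1.
Proof. by rewrite /scalar_of_real; case: k. Qed.

Lemma ge0_scalarE (a : K) : 0 <= a -> a = scalar_of_real (scalar_Re a).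
Proof.
move: a; rewrite /scalar_of_real; case: k => //= a a0.
by rewrite RRe_real// ger0_real.
Qed.

Section norm.
Context {V : normedModType K}.
Implicit Types (u v : V) (a : K).

Lemma normE v : `|v| = scalar_of_real (rnorm v).
Proof. exact: ge0_scalarE. Qed.

Lemma rnorm_ge0 v : 0 <= rnorm v.
Proof. by rewrite -ler_scalar -normE scalar_of_real0. Qed.

Lemma rnorm0 : rnorm (0 : V) = 0.
Proof. by rewrite /rnorm normr0 -scalar_of_real0 scalar_of_realK. Qed.

Lemma rnorm0_eq0 v : rnorm v = 0 -> v = 0.
Proof. by move=> v0; apply/eqP; rewrite -normr_eq0 normE v0 scalar_of_real0. Qed.

Lemma rnormD u v : rnorm (u + v) <= rnorm u + rnorm v.
Proof. by rewrite -ler_scalar scalar_of_realD -!normE ler_normD. Qed.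

Lemma rnormZ a v : rnorm (a *: v) = rnorm (a : K^o) * rnorm v.
Proof.
apply: (can_inj scalar_of_realK); rewrite scalar_of_realM -normE normrZ.
by rewrite normE (ge0_scalarE (normr_ge0 a)).
Qed.

Lemma rnormN v : rnorm (- v) = rnorm v.
Proof. by rewrite /rnorm normrN. Qed.

Lemma rnormB u v : rnorm (u - v) = rnorm (v - u).
Proof. by rewrite -rnormN opprB. Qed.

Lemma rnorm_sum I (s : seq I) (F : I -> V) :
  rnorm (\sum_(i <- s) F i) <= \sum_(i <- s) rnorm (F i).
Proof.
elim/big_ind2 : _ => //; first by rewrite rnorm0.
by move=> x r y t xr yt; apply: le_trans (rnormD _ _) (lerD xr yt).
Qed.

Lemma nbhs_rnormP v (A : set V) :
  nbhs v A <-> exists2 e : R, 0 < e & forall w, rnorm (v - w) < e -> A w.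
Proof.
split=> [/nbhs_normP[e /= e0 eA]|[e e0 eA]].
  have eE := ge0_scalarE (ltW e0); exists (scalar_Re e).
    by rewrite -ltr_scalar -eE scalar_of_real0.
  by move=> w vw; apply: eA; rewrite /= normE eE ltr_scalar.
apply/nbhs_normP; exists (scalar_of_real e) => /=.
  by rewrite -scalar_of_real0 ltr_scalar.
by move=> w; rewrite /= normE ltr_scalar; exact: eA.
Qed.

Lemma ler_dist_rnorm u v : `|rnorm u - rnorm v| <= rnorm (u - v).
Proof.
rewrite ler_norml; apply/andP; split.
  rewrite lerBrDl addrC -lerBrDl opprK [leRHS]addrC rnormB.
  by rewrite -[X in rnorm X <= _](subrK u) rnormD.
by rewrite lerBlDr -[X in rnorm X <= _](subrK v) rnormD.
Qed.

Lemma rnorm_continuous : continuous (@rnorm R k V).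
Proof.
move=> v A /nbhs_ballP[e /= e0 eA]; apply/nbhs_rnormP; exists e => // w vw.
by apply: eA; rewrite -ball_normE /=; apply: le_lt_trans vw; exact: ler_dist_rnorm.
Qed.

End norm.

Lemma rnorm_real r : 0 <= r -> rnorm (scalar_of_real r : K^o) = r.
Proof.
move=> r0; rewrite /rnorm ger0_norm ?scalar_of_realK//.
by rewrite -scalar_of_real0 ler_scalar.
Qed.

End scalars.

Lemma rnorm_complex_le (R : realType) (z : scalar_field R ComplexScalars) :
  [/\ `|complex.Re z| <= rnorm (z : (scalar_field R ComplexScalars)^o),
      `|complex.Im z| <= rnorm (z : (scalar_field R ComplexScalars)^o) &
      rnorm (z : (scalar_field R ComplexScalars)^o) <=
        `|complex.Re z| + `|complex.Im z|].
Proof.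
have -> : rnorm (z : (scalar_field R ComplexScalars)^o) =
    Num.sqrt (complex.Re z ^+ 2 + complex.Im z ^+ 2).
  exact: (congr1 (@complex.Re R) (normc_def (z : R[i]))).
split.
- by rewrite -sqrtr_sqr ler_wsqrtr// lerDl sqr_ge0.
- by rewrite -sqrtr_sqr ler_wsqrtr// lerDr sqr_ge0.
rewrite -[leRHS]ger0_norm ?addr_ge0// -[leRHS]sqrtr_sqr ler_wsqrtr//.
rewrite sqrrD !real_normK ?num_real// addrAC lerDl mulrn_wge0//.
Qed.

Lemma closed_rnorm_le (R : realType) (k : scalar_kind)
  (V : normedModType (scalar_field R k)) (M : R) :
  closed [set v : V | rnorm v <= M].
Proof.
rewrite (_ : [set _ | _] = (@rnorm R k V) @^-1` [set r | r <= M])//.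
by apply: closed_comp => // v _; exact: rnorm_continuous.
Qed.

(** A closed disc of scalars; in the complex case it is a closed subset of the
    image of a square. *)
Lemma compact_disc (R : realType) (k : scalar_kind) (M : R) :
  compact [set a : (scalar_field R k)^o | rnorm a <= M].
Proof.
case: k.
  rewrite (_ : [set _ | _] = `[- M, M]%classic); first exact: segment_compact.
  by apply/seteqP; split => x /=; rewrite in_itv/= /rnorm/= ler_norml.
pose g (x : R * R) : (scalar_field R ComplexScalars)^o := (x.1 +i* x.2)%C.
have cg : continuous g.
  move=> x A /nbhs_rnormP[e e0 eA].
  exists (ball x.1 (e / 2), ball x.2 (e / 2)).
    by split; apply: nbhsx_ballx; rewrite divr_gt0.
  move=> y [/= xy1 xy2]; apply: eA.
  have [_ _ /le_lt_trans] := rnorm_complex_le (g x - g y); apply.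
  rewrite [ltRHS]splitr; apply: ltrD.
    by move: xy1; rewrite -ball_normE.
  by move: xy2; rewrite -ball_normE.
apply: (@subclosed_compact _ _ (g @` (`[- M, M] `*` `[- M, M]))).
- exact: closed_rnorm_le.
- apply: continuous_compact; first exact: continuous_subspaceT.
  by apply: compact_setX; exact: segment_compact.
move=> z /= zM; have [h1 h2 _] := rnorm_complex_le z.
exists (complex.Re z, complex.Im z); last by case: (z).
by split; rewrite /= in_itv /= -ler_norml; exact: le_trans zM.
Qed.

(** * Weak-star topology of the dual ball *)

(** A function that is linear as a proposition is a bundled linear map. *)
Lemma linear_pack (K : pzRingType) (U W : lmodType K) (f : U -> W) :
  linear f -> exists g : {linear U -> W}, f = g.
Proof.
move=> lf; pose L := GRing.isLinear.Build K U W *:%R f lf.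
by pose g : {linear U -> W} := HB.pack f L; exists g.
Qed.

Section dual_ball_topology.
Context {R : realType} {k : scalar_kind}.
Local Notation K := (scalar_field R k).
Variable Z : normedModType K.

(** For linear maps, continuity and norm at most one amount to the pointwise
    bound. *)
Lemma dual_ball_setP (f : Z -> K^o) :
  @dual_ball_set R k Z f <->
  linear f /\ forall z, rnorm (f z) <= rnorm z.
Proof.
split=> [[lf _ f1]|[lf f1]]; split => //.
- move: (lf) f1 => /linear_pack[g ->] g1 z.
  have [z0|zN0] := eqVneq (rnorm z) 0.
    by rewrite (rnorm0_eq0 z0) linear0 !rnorm0.
  have zp : 0 < rnorm z by rewrite lt_neqAle eq_sym zN0 rnorm_ge0.
  have nc : rnorm (scalar_of_real (rnorm z)^-1 : K^o) = (rnorm z)^-1.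
    by rewrite rnorm_real// invr_ge0 ltW.
  have : ((rnorm (g ((scalar_of_real (rnorm z)^-1 : K) *: z) : K^o))%:E <= 1%:E)%E.
    apply: le_trans g1; apply: ereal_sup_ubound.
    by exists ((scalar_of_real (rnorm z)^-1 : K) *: z) => //=; rewrite rnormZ nc mulVf.
  by rewrite lee_fin linearZ rnormZ nc ler_pdivrMl// mulr1.
- move: lf f1 => /linear_pack[g ->] g1 z A /nbhs_rnormP[e e0 eA].
  apply/nbhs_rnormP; exists e => // w zw; apply: eA.
  by rewrite -linearB; exact: le_lt_trans zw.
- apply: ge_ereal_sup => _ [z /= z1 <-]; rewrite lee_fin; exact: le_trans z1.
Qed.

Lemma dual_ball_linear (f : dual_ball Z) : linear (set_val f : Z -> K^o).
Proof. by have [] := set_valP f. Qed.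

Lemma dual_ball_rnorm_le (f : dual_ball Z) z :
  rnorm (set_val f z : K^o) <= rnorm z.
Proof. by have /dual_ball_setP[_ ] := set_valP f; apply. Qed.

Lemma eval_continuous z : continuous (fun f : {ptws Z -> K^o} => f z : K^o).
Proof. exact: (@proj_continuous Z (fun _ => K^o) z). Qed.

Lemma dual_ball_eval_continuous z :
  continuous (fun f : dual_ball Z => set_val f z : K^o).
Proof.
move=> f.
apply: (@continuous_comp (dual_ball Z) {ptws Z -> K^o} K^o set_val (fun g => g z)).
  exact: initial_continuous.
exact: eval_continuous.
Qed.

(** The Banach-Alaoglu theorem: the ball is the closed set of linear functions
    inside a product of discs. *)
Lemma compact_dual_ball_set : compact (@dual_ball_set R k Z).
Proof.
pose B := [set f : {ptws Z -> K^o} | forall z, [set a : K^o | rnorm a <= rnorm z] (f z)].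
pose l (a : K) (u v : Z) (f : {ptws Z -> K^o}) : K^o :=
  f (a *: u + v) - (a *: (f u : K^o) + f v).
pose L := [set f : {ptws Z -> K^o} | forall a u v, rnorm (l a u v f) <= 0].
have -> : @dual_ball_set R k Z = B `&` L.
  apply/seteqP; split => f /=.
    move=> /dual_ball_setP[lf f1]; split => // a u v.
    by rewrite /l lf subrr rnorm0.
  move=> [f1 fl]; apply/dual_ball_setP; split => // a u v.
  apply/eqP; rewrite -subr_eq0; apply/eqP/rnorm0_eq0/eqP.
  by rewrite eq_le fl rnorm_ge0.
apply: compact_closedI.
  apply: (@tychonoff Z (fun _ => K^o) (fun z => [set a : K^o | rnorm a <= rnorm z])).
  by move=> z; exact: compact_disc.
have -> : L = \bigcap_a \bigcap_u \bigcap_v (l a u v @^-1` [set b : K^o | rnorm b <= 0]).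
  by apply/seteqP; split => f /= fl a; [move=> _ u _ v _|move=> u v]; exact: fl.
apply: closed_bigI => a _; apply: closed_bigI => u _; apply: closed_bigI => v _.
apply: closed_comp => [f _|]; last exact: (@closed_rnorm_le R k K^o 0).
have e w : (fun g : {ptws Z -> K^o} => g w : K^o) @ f --> (f w : K^o).
  exact: (@eval_continuous w f).
have e1 : (fun g : {ptws Z -> K^o} => a *: (g u : K^o) + g v) @ f -->
    a *: (f u : K^o) + (f v : K^o).
  exact: (cvgD (cvgZl_tmp (k := a) (e u)) (e v)).
have e2 : l a u v @ f --> l a u v f := cvgB (e _) e1.
exact: e2.
Qed.

Lemma compact_dual_ball : compact [set: dual_ball Z].
Proof.
pose g (f : {ptws Z -> K^o}) : dual_ball Z := insubd (dual_ball0 Z) f.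
have gK (f : dual_ball Z) : g (set_val f) = f by exact: valKd.
have <- : g @` @dual_ball_set R k Z = setT.
  apply/seteqP; split => // f _; exists (set_val f) => //; exact: set_valP.
apply: continuous_compact; last exact: compact_dual_ball_set.
apply/subspace_sigL_continuousP.
rewrite (_ : sigL _ _ = id); first by move=> f; exact: cvg_id.
by apply/funext => f; exact: gK.
Qed.

Lemma hausdorff_dual_ball : hausdorff_space (dual_ball Z).
Proof.
move=> f g fg; apply: val_inj; apply/funext => z.
apply: (@norm_hausdorff _ K^o) => A B Az Bz.
have [h [hA hB]] := fg _ _ (dual_ball_eval_continuous Az) (dual_ball_eval_continuous Bz).
by exists (set_val h z).
Qed.

End dual_ball_topology.

(** * Bounded multilinear maps *)

Section multilinear.
Context {R : realType} {k : scalar_kind} {n : nat}.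
Local Notation K := (scalar_field R k).
Context {X : 'I_n -> normedModType K}.
Implicit Types (x a : prod_topology X) (i : 'I_n).

Lemma dfwith_id x i : dfwith x i (x i) = x.
Proof. by apply: functional_extensionality_dep => j; case: dfwithP. Qed.

Section algebra.
Context {W : lmodType K} {A : prod_topology X -> W}.
Hypothesis mA : multilinear A.

Lemma multilinearB x i (u v : X i) :
  A (dfwith x i (u - v)) = A (dfwith x i u) - A (dfwith x i v).
Proof.
have [g gE] := linear_pack (@mA x i).
have E w : A (dfwith x i w) = g w by rewrite -gE.
by rewrite !E linearB.
Qed.

Lemma multilinearZ x i c (u : X i) :
  A (dfwith x i (c *: u)) = c *: A (dfwith x i u).
Proof.
have [g gE] := linear_pack (@mA x i).
have E w : A (dfwith x i w) = g w by rewrite -gE.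
by rewrite !E linearZ.
Qed.

Lemma multilinear_eq0 x i : x i = 0 -> A x = 0.
Proof.
by move=> xi0; rewrite -(dfwith_id x i) xi0 -[0](scale0r (0 : X i)) multilinearZ scale0r.
Qed.

Lemma multilinear_scale (c : 'I_n -> K) x :
  A (fun i => c i *: x i) = (\prod_i c i) *: A x.
Proof.
pose h (s : seq 'I_n) : prod_topology X :=
  fun i => if i \in s then c i *: x i else x i.
have hA s : uniq s -> A (h s) = (\prod_(i <- s) c i) *: A x.
  elim: s => [_|i s IH /= /andP[iNs us]]; first by rewrite big_nil scale1r.
  have -> : h (i :: s) = dfwith (h s) i (c i *: h s i).
    apply: functional_extensionality_dep => j; rewrite /h in_cons.
    have [->|ji] := eqVneq j i; first by rewrite dfwithin (negbTE iNs).
    by rewrite dfwithout // eq_sym.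
  by rewrite multilinearZ dfwith_id IH// big_cons scalerA.
have := hA (index_enum 'I_n) (index_enum_uniq _) => <-.
congr (A _); apply: functional_extensionality_dep => i.
by rewrite /h mem_index_enum.
Qed.

(** A scalar multiple of a sum of elementary tensors, the scalar being absorbed
    in the coordinate [i]. *)
Lemma sum_multilinearZ i c (s : seq (prod_topology X)) :
  \sum_(x <- [seq dfwith x i (c *: x i) | x <- s]) A x = c *: \sum_(x <- s) A x.
Proof.
by rewrite big_map scaler_sumr; apply: eq_bigr => x _; rewrite multilinearZ dfwith_id.
Qed.

End algebra.

(** Normalize all coordinates, unless one of them vanishes. *)
Lemma multilinear_rnorm_le (W : normedModType K) (A : prod_topology X -> W) x :
  multilinear A -> (multilinear_norm A <= 1)%E ->
  rnorm (A x) <= \prod_i rnorm (x i).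
Proof.
move=> mA A1.
have [[i xi0]|xN0] := pselect (exists i, x i = 0).
  rewrite (multilinear_eq0 mA xi0) rnorm0; apply: prodr_ge0 => j _.
  exact: rnorm_ge0.
have xp i : 0 < rnorm (x i).
  rewrite lt_neqAle rnorm_ge0 andbT eq_sym; apply/eqP => /rnorm0_eq0 xi0.
  by apply: xN0; exists i.
pose y : prod_topology X := fun i => (scalar_of_real (rnorm (x i))^-1 : K) *: x i.
have yE : A y = (\prod_i scalar_of_real (rnorm (x i))^-1) *: A x.
  exact: multilinear_scale.
have prodE : \prod_i (scalar_of_real (rnorm (x i))^-1 : K) =
    scalar_of_real (\prod_i rnorm (x i))^-1.
  rewrite -prodfV; elim: (index_enum _) => [|i s IH].
    by rewrite !big_nil scalar_of_real1.
  by rewrite !big_cons IH scalar_of_realM.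
have pp : 0 < \prod_i rnorm (x i) by apply: prodr_gt0 => i _.
have : ((rnorm (A y))%:E <= 1%:E)%E.
  apply: le_trans A1; apply: ereal_sup_ubound; exists y => //= i.
  by rewrite rnormZ rnorm_real ?invr_ge0 ?rnorm_ge0// mulVf// gt_eqF.
rewrite lee_fin yE prodE rnormZ rnorm_real ?invr_ge0 ?(ltW pp)//.
by rewrite ler_pdivrMl// mulr1.
Qed.

Lemma multilinear_continuous (W : normedModType K) (A : prod_topology X -> W) :
  multilinear A -> (forall x, rnorm (A x) <= \prod_i rnorm (x i)) ->
  continuous A.
Proof.
move=> mA Ale a.
pose B := \prod_i (rnorm (a i) + 1).
have b1 i : 1 <= rnorm (a i) + 1 by rewrite lerDr rnorm_ge0.
have B0 : 0 <= B by apply: prodr_ge0 => i _; exact: le_trans (b1 i).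
(* the coordinates of [a] are changed into those of [x] one at a time *)
have key x : (forall i, rnorm (a i - x i) <= 1) ->
    rnorm (A a - A x) <= \sum_i rnorm (a i - x i) * B.
  move=> ax1.
  pose h (s : seq 'I_n) : prod_topology X := fun i => if i \in s then x i else a i.
  have hle s j : rnorm (h s j) <= rnorm (a j) + 1.
    rewrite /h; case: ifP => _; last by rewrite lerDl.
    rewrite -[x j](subrK (a j)) addrC; apply: le_trans (rnormD _ _) _.
    by rewrite lerD2l rnormB.
  have hA s : uniq s -> rnorm (A a - A (h s)) <= \sum_(i <- s) rnorm (a i - x i) * B.
    elim: s => [_|i s IH /= /andP[iNs us]].
      by rewrite (_ : h [::] = a) ?subrr ?rnorm0 ?big_nil.
    have h1 : h (i :: s) = dfwith (h s) i (x i).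
      apply: functional_extensionality_dep => j; rewrite /h in_cons.
      have [->|ji] := eqVneq j i; first by rewrite dfwithin.
      by rewrite dfwithout // eq_sym.
    have h2 : h s = dfwith (h s) i (a i).
      by rewrite -[in LHS](dfwith_id (h s) i) {2}/h (negbTE iNs).
    rewrite big_cons -[A a](subrK (A (h s))) -addrA.
    apply: le_trans (rnormD _ _) _; rewrite [leLHS]addrC; apply: lerD; last exact: IH.
    rewrite {1}h2 h1 -multilinearB//; apply: le_trans (Ale _) _.
    rewrite (bigD1 i)//= dfwithin; apply: ler_wpM2l; first exact: rnorm_ge0.
    apply: (@le_trans _ _ (\prod_(j < n | j != i) (rnorm (a j) + 1))).
      apply: ler_prod => j ji; rewrite rnorm_ge0/= dfwithout ?hle//.
      by rewrite eq_sym.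
    rewrite /B [leRHS](bigD1 i)//= ler_peMl//; apply: prodr_ge0 => j _.
    exact: le_trans (b1 j).
  have := hA (index_enum 'I_n) (index_enum_uniq _).
  rewrite (_ : h _ = x)//; apply: functional_extensionality_dep => i.
  by rewrite /h mem_index_enum.
move=> U /nbhs_rnormP[e e0 eU].
pose d := Num.min 1 (e / (n%:R * B + 1)).
have nB : 0 < n%:R * B + 1 by rewrite ltr_wpDl// mulr_ge0.
have d0 : 0 < d by rewrite lt_min ltr01 divr_gt0.
have near_a : \forall x \near a, forall i, rnorm (a i - x i) < d.
  apply: (@filter_forall _ _ (fun i (x : prod_topology X) => rnorm (a i - x i) < d) _ (nbhs_filter _)) => i.
  have : nbhs (a i) [set u | rnorm (a i - u) < d] by apply/nbhs_rnormP; exists d.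
  by move/(@proj_continuous _ X i a).
apply: (@filterS _ _ (nbhs_filter a) _ _ _ near_a) => x ax; apply: eU.
apply: le_lt_trans (key x _) _.
  by move=> i; apply: le_trans (ltW (ax i)) _; rewrite ge_min lexx.
apply: (@le_lt_trans _ _ (\sum_(i < n) d * B)).
  by apply: ler_sum => i _; rewrite ler_wpM2r// ltW.
rewrite sumr_const card_ord -mulr_natl mulrCA.
have : d <= e / (n%:R * B + 1) by rewrite ge_min lexx orbT.
rewrite ler_pdivlMr// mulrDr mulr1 => /(lt_le_trans _); apply.
by rewrite ltrDl.
Qed.

End multilinear.

(** * Functionals on the projective tensor product *)

Section projective_tensor.
Context {R : realType} {k : scalar_kind} {n : nat}.
Local Notation K := (scalar_field R k).
Context {X : 'I_n -> normedModType K} {Z : completeNormedModType K}.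
Context {tau : prod_topology X -> Z}.
Implicit Types x : prod_topology X.
Hypothesis Htau : completed_projective_tensor tau.

Let mtau : multilinear tau. Proof. by have [] := Htau. Qed.

Let tau_norm (s : seq (prod_topology X)) :
  rnorm (\sum_(x <- s) tau x) = projective_norm s.
Proof. by have [_ + _] := Htau; apply. Qed.

Lemma projective_norm_set_ge0 (s : seq (prod_topology X)) :
  lbound [set \sum_(x <- t) \prod_(i < n) rnorm (x i) |
        t in [set t | same_tensor s t]] 0.
Proof.
move=> _ [t _ <-]; apply: sumr_ge0 => x _; apply: prodr_ge0 => i _.
exact: rnorm_ge0.
Qed.

Lemma tau_rnorm_le x : rnorm (tau x) <= \prod_i rnorm (x i).
Proof.
have := tau_norm [:: x]; rewrite big_seq1 => ->; apply: ge_inf.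
  by exists 0; exact: projective_norm_set_ge0.
by exists [:: x] => //; rewrite big_seq1.
Qed.

Lemma tau_continuous : continuous tau.
Proof. exact: multilinear_continuous mtau tau_rnorm_le. Qed.

(** Restriction of a functional of norm at most one to elementary tensors. *)
Lemma dual_ball_multilinear (f : dual_ball Z) :
  @multilinear_form_ball R k n X (fun x => set_val f (tau x)).
Proof.
split.
- move=> x i; have [g gE] := linear_pack (@mtau x i).
  have E w : tau (dfwith x i w) = g w by rewrite -gE.
  by move=> a u v; rewrite !E linearP; exact: (@dual_ball_linear _ _ _ f).
- move=> x; apply: continuous_comp; first exact: tau_continuous.
  by have [_ cf _] := set_valP f; exact: cf.
- apply: ge_ereal_sup => _ [x /= x1 <-]; rewrite lee_fin.
  apply: le_trans (dual_ball_rnorm_le f _) _; apply: le_trans (tau_rnorm_le _) _.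
  by apply: prodr_ile1 => i; rewrite rnorm_ge0 x1.
Qed.

Section lift.
Variable phi : prod_topology X -> K^o.
Hypothesis phiB : @multilinear_form_ball R k n X phi.
Variable i0 : 'I_n.

Let mphi : multilinear phi. Proof. by have [] := phiB. Qed.

(** The value of a form at a tensor does not depend on how the tensor is
    written, so it is bounded by the infimum over all writings. *)
Lemma form_le_projective_norm (s : seq (prod_topology X)) :
  rnorm (\sum_(x <- s) phi x) <= projective_norm s.
Proof.
apply: lb_le_inf.
  by exists (\sum_(x <- s) \prod_(i < n) rnorm (x i)); exists s.
move=> _ [t st <-]; rewrite (st _ mphi); apply: le_trans (rnorm_sum _ _) _.
apply: ler_sum => x _; have [_ _] := phiB; exact: multilinear_rnorm_le.
Qed.

(* The scalar is absorbed in the coordinate [i0], which exists as [n] is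
   positive. *)
Let smul (c : K) (s : seq (prod_topology X)) : seq (prod_topology X) :=
  [seq dfwith x i0 (c *: x i0) | x <- s].

(** [w] is a limit of values of [phi] along finite sums of elementary tensors
    converging to [z]. *)
Let approx (z : Z) (w : K^o) := forall e : R, 0 < e -> exists s,
  rnorm (z - \sum_(x <- s) tau x) < e /\ rnorm (w - \sum_(x <- s) phi x) < e.

Let approx_rnorm_le z w : approx z w -> rnorm w <= rnorm z.
Proof.
move=> zw; apply/ler_addgt0Pr => e e0.
have [s [zs ws]] := zw (e / 2) (divr_gt0 e0 (ltr0Sn _ 1)).
rewrite -[w](subrK (\sum_(x <- s) phi x)).
apply: le_trans (rnormD _ _) _.
have := form_le_projective_norm s; rewrite -tau_norm => h.
have := rnormD (\sum_(x <- s) tau x - z) z; rewrite subrK rnormB => h'.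
rewrite [e]splitr; lra.
Qed.

Let approx_linear a z w z' w' :
  approx z w -> approx z' w' -> approx (a *: z + z') (a *: w + w').
Proof.
move=> zw zw' e e0; pose d := e / (rnorm (a : K^o) + 1).
have a1 : 0 < rnorm (a : K^o) + 1 by rewrite ltr_wpDl// rnorm_ge0.
have d0 : 0 < d by rewrite divr_gt0.
have [s [zs ws]] := zw d d0; have [t [zt wt]] := zw' d d0.
have comb (V : normedModType K) (u u' v v' : V) :
    rnorm (u - v) < d -> rnorm (u' - v') < d ->
    rnorm ((a *: u + u') - (a *: v + v')) < e.
  move=> uv uv'; rewrite opprD addrACA -scalerBr.
  apply: le_lt_trans (rnormD _ _) _; rewrite rnormZ.
  have -> : e = rnorm (a : K^o) * d + d.
    by rewrite -[X in _ = _ + X]mul1r -mulrDl /d mulrC divfK// gt_eqF.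
  by apply: ler_ltD => //; apply: ler_wpM2l; [exact: rnorm_ge0|exact: ltW].
exists (smul a s ++ t); rewrite !big_cat/= (sum_multilinearZ mtau) (sum_multilinearZ mphi).
by split; exact: comb.
Qed.

Let approx_tau x : approx (tau x) (phi x).
Proof. by move=> e e0; exists [:: x]; rewrite !big_seq1 !subrr !rnorm0. Qed.

Let approx_unique z w w' : approx z w -> approx z w' -> w = w'.
Proof.
move=> zw zw'; apply/esym/eqP; rewrite -subr_eq0; apply/eqP/rnorm0_eq0/eqP.
rewrite eq_le rnorm_ge0 andbT.
have := approx_rnorm_le (approx_linear (-1) zw zw').
by rewrite !scaleN1r addNr rnorm0 addrC.
Qed.

(** The values of [phi] on sums approaching [z] stay in a compact disc, and any
    cluster point of them is a limit value at [z]. *)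
Let approx_exists z : exists w, approx z w.
Proof.
have [_ _ dtau] := Htau.
pose D (e : R) := [set w : K^o | exists2 s, rnorm (z - \sum_(x <- s) tau x) < e &
   w = \sum_(x <- s) phi x].
pose F := filter_from [set e : R | 0 < e] D.
have DF : ProperFilter F.
  apply: filter_from_proper.
    apply: filter_from_filter; first by exists 1 => /=.
    move=> d e /= d0 e0; exists (Num.min d e); first by rewrite /= lt_min d0.
    move=> w [s zs ->]; move: zs; rewrite lt_min => /andP[zd ze].
    by split; exists s.
  move=> e /= e0.
  have := dtau [set y | rnorm (z - y) < e]; case.
  - by exists z; rewrite /= subrr rnorm0.
  - rewrite openE => y /= zy; apply/nbhs_rnormP.
    exists (e - rnorm (z - y)); first by rewrite subr_gt0.
    move=> y' yy'; rewrite /= -[z](subrK y) -addrA.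
    by apply: le_lt_trans (rnormD _ _) _; rewrite -ltrBrDl.
  by move=> y [/= zy [s _ sy]]; exists (\sum_(x <- s) phi x), s => //; rewrite sy.
have [|w [_ wF]] := @compact_disc R k (rnorm z + 1) F DF.
  exists 1 => //= w [s zs ->].
  have := form_le_projective_norm s; rewrite -tau_norm => h.
  have := rnormD (\sum_(x <- s) tau x - z) z; rewrite subrK rnormB => h' /=.
  lra.
exists w => e e0.
have FD : F (D e) by exists e.
have nw : nbhs w [set w' : K^o | rnorm (w - w') < e] by apply/nbhs_rnormP; exists e.
by have [_ [[s zs ->] /= ws]] := wF _ _ FD nw; exists s.
Qed.

(** Every [n]-linear form in the unit ball is induced by an element of the
    unit ball of the dual of the projective tensor product. *)
Lemma form_lift : exists f : dual_ball Z, forall x, set_val f (tau x) = phi x.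
Proof.
have /choice[f fP] := approx_exists.
have fB : @dual_ball_set R k Z f.
  apply/dual_ball_setP; split => [a u v|z]; last exact: approx_rnorm_le.
  exact: approx_unique (fP _) (approx_linear a (fP u) (fP v)).
exists (SigSub (mem_set fB)) => x.
exact: approx_unique (fP _) (approx_tau x).
Qed.

End lift.
End projective_tensor.

(** * Real powers *)

Section powers.
Context {R : realType}.
Implicit Types (p x y : R).

Lemma powRK p x : p != 0 -> 0 <= x -> (x `^ p) `^ p^-1 = x.
Proof. by move=> p0 x0; rewrite -powRrM mulfV// powRr1. Qed.

Lemma powRVK p x : p != 0 -> 0 <= x -> (x `^ p^-1) `^ p = x.
Proof. by move=> p0 x0; rewrite -powRrM mulVf// powRr1. Qed.

Lemma ler_powR2 p x y : 0 < p -> 0 <= x -> 0 <= y ->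
  (x `^ p <= y `^ p) = (x <= y).
Proof.
move=> p0 x0 y0; apply/idP/idP; last by apply: ge0_ler_powR; rewrite ?nnegrE// ltW.
by apply: contraTT; rewrite -!ltNge; apply: gt0_ltr_powR; rewrite ?nnegrE.
Qed.

Lemma powR_continuous_ge0 (T : topologicalType) (f : T -> R) p : 0 < p ->
  (forall t, 0 <= f t) -> continuous f -> continuous (fun t => f t `^ p).
Proof.
move=> p0 f0 cf t; have [ft0|ftN0] := eqVneq (f t) 0.
  move=> A /nbhs_ballP[e /= e0 eA].
  have d0 : 0 < e `^ p^-1 by exact: powR_gt0.
  have /cf := nbhsx_ballx (f t) _ d0.
  rewrite /nbhs /=; apply: filterS => s /=.
  rewrite -ball_normE /= ft0 sub0r normrN ger0_norm// => fs.
  apply: eA; rewrite -ball_normE /= ft0 powR0 ?gt_eqF// sub0r normrN.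
  rewrite ger0_norm ?powR_ge0//.
  rewrite -[ltRHS](@powRVK p) ?gt_eqF// ?ltW//.
  by apply: gt0_ltr_powR; rewrite ?nnegrE// ltW.
apply: (@continuous_comp _ _ _ f (@powR R ^~ p)); first exact: cf.
apply: differentiable_continuous; apply/derivable1_diffP.
by apply: derivable_powR; rewrite in_itv/= andbT lt_neqAle eq_sym ftN0 f0.
Qed.

End powers.

(** * Domination theorem *)

Section domination_of_tensors.
Context {R : realType} {k : scalar_kind}.
Local Notation K := (scalar_field R k).
Context {Z : normedModType K}.

Lemma dual_ball_sum (f : dual_ball Z) I (s : seq I) (c : I -> K) (z : I -> Z) :
  set_val f (\sum_(i <- s) c i *: z i) = \sum_(i <- s) c i *: (set_val f (z i) : K^o).
Proof.
have [g gE] := linear_pack (@dual_ball_linear _ _ _ f).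
by rewrite gE linear_sum; apply: eq_bigr => i _; rewrite linearZ.
Qed.

Lemma dual_ball_powR_continuous p (z : Z) : 0 < p ->
  continuous (fun f : dual_ball Z => rnorm (set_val f z : K^o) `^ p).
Proof.
move=> p0; apply: powR_continuous_ge0 => // [f|f]; first exact: rnorm_ge0.
apply: (@continuous_comp _ _ _ (fun f : dual_ball Z => set_val f z : K^o) (@rnorm R k K^o)).
  exact: dual_ball_eval_continuous.
exact: rnorm_continuous.
Qed.

Lemma measurable_dual_ball_powR p (z : Z) : 0 < p ->
  measurable_fun [set: dual_ball_borel Z]
    (fun f : dual_ball_borel Z => rnorm (set_val f z : K^o) `^ p).
Proof.
by move=> p0; apply: continuous_measurable_borel; exact: dual_ball_powR_continuous.
Qed.

End domination_of_tensors.

Section summing.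
Context {R : realType} {k : scalar_kind} {n : nat}.
Local Notation K := (scalar_field R k).
Context {X : 'I_n -> normedModType K}.

(** The value at the tensor [\sum_(c <- l) c.1 *: (c.2_1 (x) ... (x) c.2_n)] of
    the linear map induced by [A], when [A] is multilinear. *)
Definition on_tensor (W : lmodType K) (A : prod_topology X -> W)
  (l : seq (K * prod_topology X)) : W := \sum_(c <- l) c.1 *: A c.2.

(** The tensor [a *: l]. *)
Definition scale_tensor (a : K) (l : seq (K * prod_topology X)) :=
  [seq (a * c.1, c.2) | c <- l].

Lemma on_scale_tensor (W : lmodType K) (A : prod_topology X -> W) a l :
  on_tensor A (scale_tensor a l) = a *: on_tensor A l.
Proof.
by rewrite /on_tensor big_map scaler_sumr; apply: eq_bigr => c _; rewrite scalerA.
Qed.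

Lemma on_tensor_ord (W : lmodType K) (A : prod_topology X -> W) l m d :
  (size l <= m)%N -> d.1 = 0 ->
  \sum_(i < m) (nth d l i).1 *: A (nth d l i).2 = on_tensor A l.
Proof.
move=> lm d0; rewrite /on_tensor (big_nth d) -(subnKC lm) big_split_ord/=.
rewrite [X in _ + X]big1 ?addr0 ?big_mkord//.
by move=> i _; rewrite nth_default ?leq_addr// d0 scale0r.
Qed.

Lemma multilinear_form_ball0 : @multilinear_form_ball R k n X (fun _ => 0).
Proof.
split; first by move=> x i a u v; rewrite scaler0 addr0.
  exact: cst_continuous.
by apply: ge_ereal_sup => _ [x _ <-]; rewrite lee_fin rnorm0.
Qed.

(** The summing inequality for finite families of tensors of any lengths,
    obtained by padding them to a common length. *)
Lemma summing_tensors (Y : normedModType K) p (T : prod_topology X -> Y) :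
  1 <= p -> factorable_strongly_summing p T -> exists2 C : R, 0 <= C &
  forall L : seq (seq (K * prod_topology X)),
  (((\sum_(l <- L) rnorm (on_tensor T l) `^ p) `^ p^-1)%:E <=
   C%:E * ereal_sup
     [set ((\sum_(l <- L) rnorm (on_tensor phi l) `^ p) `^ p^-1)%:E |
        phi in @multilinear_form_ball R k n X])%E.
Proof.
move=> p1 [C C0 HC]; exists C => // L.
have p0 : p^-1 != 0 by rewrite invr_eq0 gt_eqF// (lt_le_trans ltr01).
case: L => [|l0 L0].
  rewrite big_nil powR0//; apply: mule_ge0; first by rewrite lee_fin.
  apply: ereal_sup_ubound; exists (fun _ => 0); first exact: multilinear_form_ball0.
  by rewrite big_nil powR0.
set L := l0 :: L0.
(* The padding tensor has scalar zero. *)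
pose d : K * prod_topology X := (0, fun _ => 0).
pose m := (\max_(l <- L) size l).+1.
have sL (j : 'I_(size L)) : (size (nth [::] L j) <= m)%N.
  apply: leqW; apply: (@leq_bigmax_seq _ _ xpredT size) => //.
  exact: mem_nth.
have E (W : normedModType K) (A : prod_topology X -> W) :
    \sum_(j < size L) rnorm (\sum_(i < m)
      (nth d (nth [::] L j) i).1 *: A (nth d (nth [::] L j) i).2) `^ p =
    \sum_(l <- L) rnorm (on_tensor A l) `^ p.
  rewrite (big_nth [::]) big_mkord; apply: eq_bigr => j _.
  by rewrite (on_tensor_ord A (sL j)).
have := HC (size L) m (fun j i => (nth d (nth [::] L j) i).1)
  (fun j i => (nth d (nth [::] L j) i).2) isT isT.
rewrite E; under eq_imagel do rewrite (E K^o).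
done.
Qed.

End summing.

Section pietsch.
Context {R : realType} {k : scalar_kind} {n : nat}.
Local Notation K := (scalar_field R k).
Context {X : 'I_n -> normedModType K} {Y : normedModType K}.
Context {Z : completeNormedModType K}.
Context {tau : prod_topology X -> Z} {T : prod_topology X -> Y} {p : R}.
Hypotheses (p1 : 1 <= p) (Htau : completed_projective_tensor tau).

Let p_gt0 : 0 < p. Proof. exact: lt_le_trans p1. Qed.
Let pV_gt0 : 0 < p^-1. Proof. by rewrite invr_gt0. Qed.

Lemma on_tensor_tau (f : dual_ball Z) l :
  set_val f (on_tensor tau l) = on_tensor (fun x => set_val f (tau x) : K^o) l.
Proof. exact: dual_ball_sum. Qed.

(** The index [i0] in ['I_n] stands for [0 < n]. *)
Lemma pietsch_domination : 'I_n -> factorable_strongly_summing p T ->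
  exists (mu : probability (dual_ball_borel Z) R) (C : R),
    [/\ regular_measure mu, 0 <= C & forall l,
      ((rnorm (on_tensor T l))%:E <= C%:E *
        (\int[mu]_(f in [set: dual_ball_borel Z])
          (rnorm (set_val f (on_tensor tau l) : K^o) `^ p)%:E) `^ p^-1)%E].
Proof.
move=> i0 /(summing_tensors p1)[C C0 HC].
pose I := seq (K * prod_topology X).
pose g (l : I) (f : dual_ball Z) : R := rnorm (set_val f (on_tensor tau l) : K^o) `^ p.
pose F (l : I) (f : dual_ball Z) : R := C `^ p * g l f.
have cF l : continuous (F l).
  move=> f; apply: (@continuous_comp _ _ _ (g l) ( *%R (C `^ p))).
    exact: dual_ball_powR_continuous.
  exact: mulrl_continuous.
have F0 l f : 0 <= F l f by rewrite mulr_ge0// powR_ge0.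
have [|mu [rmu Hmu]] := @regular_domination R (dual_ball Z)
    (@compact_dual_ball R k Z) (@hausdorff_dual_ball R k Z) I F
    (fun l => rnorm (on_tensor T l) `^ p) cF F0.
  move=> w w0; apply: contrapT => /forallNP Hlt.
  pose a := \sum_(c <- w) c.1 * rnorm (on_tensor T c.2) `^ p.
  (* A weight is absorbed by scaling the tensor with its [p]-th root. *)
  pose sc (c : R * I) := scale_tensor (scalar_of_real (c.1 `^ p^-1) : K) c.2.
  have scE (W : normedModType K) (A : prod_topology X -> W) :
      \sum_(l <- [seq sc c | c <- w]) rnorm (on_tensor A l) `^ p =
      \sum_(c <- w) c.1 * rnorm (on_tensor A c.2) `^ p.
    rewrite big_map; elim: (w) w0 => [|c v IH /= /andP[c0 v0]]; first by rewrite !big_nil.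
    rewrite !big_cons IH//; congr (_ + _).
    rewrite on_scale_tensor rnormZ rnorm_real ?powR_ge0//.
    by rewrite powRM ?powR_ge0 ?rnorm_ge0// powRVK// gt_eqF.
  (* If every [f] violates the combination by more than one, the two sides of
     the summing inequality are too far apart. *)
  have lt_a (f : dual_ball Z) : \sum_(c <- w) c.1 * F c.2 f <= a - 1.
    by rewrite lerBrDr leNgt; apply/negP => /ltW; exact: Hlt.
  have a1 : 0 <= a - 1.
    apply: le_trans (lt_a (dual_ball0 Z)).
    elim: (w) w0 => [|c v IH /= /andP[c0 v0]]; first by rewrite big_nil.
    by rewrite big_cons addr_ge0 ?IH// mulr_ge0.
  have := HC [seq sc c | c <- w]; rewrite scE -/a => aC.
  suff : ((a `^ p^-1)%:E <= ((a - 1) `^ p^-1)%:E)%E.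
    rewrite lee_fin ler_powR2//; last by rewrite (le_trans a1)// gerBl.
    by rewrite lerBrDr gerDl ler10.
  apply: le_trans aC _.
  have Cphi phi : @multilinear_form_ball R k n X phi ->
      C * (\sum_(l <- [seq sc c | c <- w]) rnorm (on_tensor phi l) `^ p) `^ p^-1
      <= (a - 1) `^ p^-1.
    move=> phiB; have [f fphi] := form_lift Htau phiB i0.
    rewrite (scE K^o) -[X in X * _](@powRK _ p) ?gt_eqF// -powRM ?powR_ge0//; last first.
      elim: (w) w0 => [|c v IH /= /andP[c0 v0]]; first by rewrite big_nil.
      by rewrite big_cons addr_ge0 ?IH// mulr_ge0// powR_ge0.
    rewrite ler_powR2//; last first.
      apply: mulr_ge0; first exact: powR_ge0.
      elim: (w) w0 => [|c v IH /= /andP[c0 v0]]; first by rewrite big_nil.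
      by rewrite big_cons addr_ge0 ?IH// mulr_ge0// powR_ge0.
    apply: le_trans (lt_a f); rewrite mulr_sumr; apply: ler_sum => c _.
    rewrite mulrCA /F /g on_tensor_tau (_ : (fun x => _) = phi)//.
    exact/funext.
  have [C00|CN0] := eqVneq C 0.
    by rewrite C00 mul0e lee_fin powR_ge0.
  have Cp : 0 < C by rewrite lt_neqAle eq_sym CN0.
  rewrite -lee_pdivlMl//; apply: ge_ereal_sup => _ [phi phiB <-].
  by rewrite lee_pdivlMl// -EFinM lee_fin; exact: Cphi.
exists mu, C; split => // l.
set J := (\int[mu]_(f in _) _)%E.
have J0 : (0 <= J)%E by apply: integral_ge0 => f _; rewrite lee_fin powR_ge0.
have : ((rnorm (on_tensor T l) `^ p)%:E <= (C `^ p)%:E * J)%E.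
  apply: le_trans (Hmu l) _; rewrite le_eqVlt; apply/orP; left; apply/eqP.
  under eq_integral do rewrite EFinM.
  apply: ge0_integralZl => //.
  - apply/measurable_EFinP; exact: measurable_dual_ball_powR.
  - by move=> f _; rewrite lee_fin powR_ge0.
  - by rewrite lee_fin powR_ge0.
move=> /(gt0_ler_poweR (ltW pV_gt0)).
rewrite poweRM ?lee_fin ?powR_ge0// !poweR_EFin !powRK ?gt_eqF ?rnorm_ge0//.
apply; rewrite in_itv/= leey andbT ?lee_fin ?powR_ge0//.
by apply: mule_ge0 => //; rewrite lee_fin powR_ge0.
Qed.

(** Raising the domination inequality to the power [p], adding up and bounding
    the integrand by its supremum. *)
Lemma summing_of_domination (mu : probability (dual_ball_borel Z) R) (C : R) :
  0 <= C ->
  (forall (m : nat) (lambda : 'I_m -> K) (x : 'I_m -> prod_topology X), (0 < m)%N ->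
    ((rnorm (\sum_(i < m) lambda i *: T (x i)))%:E
     <= C%:E *
        (\int[mu]_(phi in [set: dual_ball_borel Z])
           (rnorm (\sum_(i < m) lambda i *: set_val phi (tau (x i)) : K^o) `^ p)%:E)
        `^ p^-1)%E) ->
  factorable_strongly_summing p T.
Proof.
move=> C0 HC; exists C => // m1 m2 lambda x m1_gt0 m2_gt0.
set S := ereal_sup _.
pose t j := rnorm (\sum_(i < m2) lambda j i *: T (x j i)).
pose g j (f : dual_ball_borel Z) : R :=
  rnorm (\sum_(i < m2) lambda j i *: set_val f (tau (x j i)) : K^o).
pose J j := (\int[mu]_(f in [set: dual_ball_borel Z]) (g j f `^ p)%:E)%E.
have J0 j : (0 <= J j)%E by apply: integral_ge0 => f _; rewrite lee_fin powR_ge0.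
have tJ j : ((t j `^ p)%:E <= (C `^ p)%:E * J j)%E.
  have : ((t j)%:E <= C%:E * J j `^ p^-1)%E := HC m2 (lambda j) (x j) m2_gt0.
  move=> /(gt0_ler_poweR (ltW p_gt0)).
  rewrite poweRM ?lee_fin ?poweR_ge0// -poweRrM mulVf ?gt_eqF// poweRe1//.
  rewrite !poweR_EFin; apply; rewrite in_itv/= leey andbT ?lee_fin ?rnorm_ge0//.
  by rewrite mule_ge0 ?lee_fin ?poweR_ge0.
have mg j : measurable_fun [set: dual_ball_borel Z] (fun f => (g j f `^ p)%:E).
  apply/measurable_EFinP.
  rewrite (_ : (fun _ => _) = (fun f : dual_ball_borel Z =>
     rnorm (set_val f (\sum_(i < m2) lambda j i *: tau (x j i)) : K^o) `^ p)).
    exact: measurable_dual_ball_powR.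
  by apply/funext => f; rewrite dual_ball_sum.
have gS (f : dual_ball Z) : (((\sum_(j < m1) g j f `^ p) `^ p^-1)%:E <= S)%E.
  apply: ereal_sup_ubound; exists (fun x => set_val f (tau x)) => //.
  exact: dual_ball_multilinear.
have S0 : (0 <= S)%E by apply: le_trans (gS (dual_ball0 Z)); rewrite lee_fin powR_ge0.
have [C00|CN0] := eqVneq C 0.
  have t0 j : t j = 0.
    apply/eqP; rewrite eq_le rnorm_ge0 andbT -lee_fin.
    by have := HC m2 (lambda j) (x j) m2_gt0; rewrite C00 mul0e.
  rewrite C00 mul0e big1 ?powR0 ?gt_eqF// => j _.
  by rewrite -/(t j) t0 powR0// gt_eqF.
have Cp : 0 < C by rewrite lt_neqAle eq_sym CN0.
case: S S0 gS => [s|_ _|//]; last by rewrite gt0_muley ?lte_fin// leey.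
rewrite lee_fin => s0 gS; rewrite -EFinM lee_fin.
have gs (f : dual_ball Z) : \sum_(j < m1) g j f `^ p <= s `^ p.
  have h : 0 <= \sum_(j < m1) g j f `^ p by apply: sumr_ge0 => j _; exact: powR_ge0.
  rewrite -[leLHS](@powRVK _ p) ?gt_eqF// ler_powR2 ?powR_ge0//.
  by rewrite -lee_fin.
have sumJ : (\sum_(j < m1) J j <= (s `^ p)%:E)%E.
  rewrite /J -ge0_integral_sum//; last by move=> j f _; rewrite lee_fin powR_ge0.
  have <- : (\int[mu]_(f in [set: dual_ball_borel Z]) (s `^ p)%:E = (s `^ p)%:E)%E.
    by rewrite integral_cst// [X in (_ * X)%E](probability_setT mu) mule1.
  apply: ge0_le_integral => //.
  - by move=> f _; apply: sume_ge0 => j _; rewrite lee_fin powR_ge0.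
  - exact: emeasurable_sum.
  - by move=> f _; rewrite sumEFin lee_fin; exact: gs.
rewrite -[C * s](@powRK _ p) ?gt_eqF ?mulr_ge0// ler_powR2 ?powR_ge0//; last first.
  by apply: sumr_ge0 => j _; exact: powR_ge0.
rewrite powRM// -lee_fin -sumEFin EFinM.
apply: (@le_trans _ _ (\sum_(j < m1) (C `^ p)%:E * J j)%E).
  by apply: lee_sum => j _; exact: tJ.
rewrite -ge0_sume_distrr//; apply: lee_wpmul2l => //.
by rewrite lee_fin powR_ge0.
Qed.

End pietsch.

Theorem theorem3p2 (R : realType) (k : scalar_kind) (p : R) (n : nat)
    (X : 'I_n -> completeNormedModType (scalar_field R k))
    (Y : completeNormedModType (scalar_field R k))
    (Z : completeNormedModType (scalar_field R k)) (tau : prod_topology X -> Z)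
    (T : prod_topology X -> Y) :
  1 <= p -> (1 <= n)%N ->
  completed_projective_tensor tau ->
  multilinear T -> continuous T ->
  factorable_strongly_summing p T <->
  exists (mu : probability (dual_ball_borel Z) R) (C : R),
    [/\ regular_measure mu, 0 <= C &
        forall (m : nat) (lambda : 'I_m -> scalar_field R k)
          (x : 'I_m -> prod_topology X), (0 < m)%N ->
        ((rnorm (\sum_(i < m) lambda i *: T (x i)))%:E
         <= C%:E *
            (\int[mu]_(phi in [set: dual_ball_borel Z])
               (rnorm (\sum_(i < m) lambda i *: set_val phi (tau (x i))) `^ p)%:E)
            `^ p^-1)%E].
Proof.
move=> p1 n1 Htau _ _; split=> [|[mu [C [rmu C0 HC]]]]; last first.
  exact: (summing_of_domination p1 Htau C0 HC).
move=> /(pietsch_domination p1 Htau (Ordinal n1))[mu [C [rmu C0 HC]]].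
exists mu, C; split => // m lambda x _.
have := HC [seq (lambda i, x i) | i <- index_enum 'I_m].
rewrite /on_tensor !big_map => /le_trans; apply.
under eq_integral do rewrite dual_ball_sum.
exact: lexx.
Qed.
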